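(* Let $X,Y$ be real normed spaces with $\dim X\ge 2$ and let $T:X\to Y$ be a nonzero linear mapping. Then the following conditions are equivalent: (i) $x\perp_{\rho_*}y\Longrightarrow Tx\perp_{\rho_*}Ty$ for all $x,y\in X$. (ii) $x\perp_{\rho_*}y\Longrightarrow Tx\perp_{B}Ty$ for all $x,y\in X$. (iii) $\|Tx\|=\|T\|\,\|x\|$ for all $x\in X$. (iv) $\rho_*(Tx,Ty)=\|T\|^4\rho_*(x,y)$ for all $x,y\in X$. If $X=Y$, then each one of these assertions is also equivalent to (v) there exists a semi-inner product $[\cdot|\cdot]:X\times X\to\mathbb{R}$ satisfying $[Tx|Ty]=\|T\|^2[x|y]$ for all $x,y\in X$.
   Context: $\|T\|=\sup\{\|Tx\|:\|x\|=1\}$ is the operator norm; conditions (iii), (iv), (v) are understood to include that $\|T\|<\infty$. The norm derivatives on a real normed space are $\rho_{\pm}(x,y):=\lim_{t\to 0^{\pm}}\frac{\|x+ty\|^2-\|x\|^2}{2t}$. Put $\rho_*(x,y):=\rho_-(x,y)\rho_+(x,y)$, and $x\perp_{\rho_*}y$ iff $\rho_*(x,y)=0$. Birkhoff–James orthogonality: $x\perp_B y$ iff $\|x\|\le\|x+\lambda y\|$ for all $\lambda\in\mathbb{R}$. A semi-inner product in $X$ is a mapping $[\cdot|\cdot]:X\times X\to\mathbb{R}$ such that for all $x,y,z\in X$, $r,t\in\mathbb{R}$: $[rx+ty|z]=r[x|z]+t[y|z]$; $[x|x]=\|x\|^2$; $|[x|y]|\le\|x\|\,\|y\|$. *)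

(* Defs.v *)
From HB Require Import structures.
From mathcomp Require Import all_boot all_order all_algebra.
From mathcomp Require Import all_classical all_reals all_analysis.

Set Implicit Arguments.
Unset Strict Implicit.
Unset Printing Implicit Defensive.

Import Order.TTheory GRing.Theory Num.Theory.
Import numFieldNormedType.Exports.

Local Open Scope classical_set_scope.
Local Open Scope ring_scope.

Definition lin_indep (R : realType) (X : lmodType R) (n : nat)
    (v : 'I_n -> X) : Prop :=
  forall c : 'I_n -> R, \sum_(i < n) c i *: v i = 0 -> forall i, c i = 0.

(* Meaningful also for infinite-dimensional X, hence no use of vectType. *)
Definition dim_ge (R : realType) (X : lmodType R) (n : nat) : Prop :=
  exists v : 'I_n -> X, lin_indep v.

Section NormDerivatives.
Context (R : realType) (X : normedModType R).
Implicit Types (x y : X).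

Definition norm_quot x y (t : R) : R :=
  (`|x + t *: y| ^+ 2 - `|x| ^+ 2) / (2 * t).

(* These one-sided limits always exist, because t |-> `|x + t *: y| ^+ 2 is
   convex; [lim] never takes its default value here. *)
Definition rho_plus x y : R := lim (norm_quot x y t @[t --> 0^'+]).

Definition rho_minus x y : R := lim (norm_quot x y t @[t --> 0^'-]).

Definition rho_star x y : R := rho_minus x y * rho_plus x y.

Definition rho_star_orth x y : Prop := rho_star x y = 0.

Definition birkhoff_orth x y : Prop :=
  forall lambda : R, `|x| <= `|x + lambda *: y|.

Record semi_inner_product (ip : X -> X -> R) : Prop := SemiInnerProduct {
  sip_linearl : forall (x y z : X) (r t : R),
    ip (r *: x + t *: y) z = r * ip x z + t * ip y z ;
  sip_norm : forall x : X, ip x x = `|x| ^+ 2 ;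
  sip_cauchy_schwarz : forall x y : X, `|ip x y| <= `|x| * `|y| }.

End NormDerivatives.

(* The operator norm as an extended real: +oo exactly when T is unbounded on
   the unit sphere. *)
Definition eopnorm (R : realType) (X Y : normedModType R) (T : X -> Y) : \bar R :=
  ereal_sup [set (`|T x|)%:E | x in [set x : X | `|x| = 1]].

(* The real value of the operator norm; only meaningful together with
   [finite_opnorm T]. *)
Definition opnorm (R : realType) (X Y : normedModType R) (T : X -> Y) : R :=
  fine (eopnorm T).

Definition finite_opnorm (R : realType) (X Y : normedModType R) (T : X -> Y)
    : Prop := (eopnorm T < +oo)%E.

(* Main.v *)
Require Import Defs.
From HB Require Import structures.
From mathcomp Require Import all_boot all_order all_algebra.
From mathcomp Require Import all_classical all_reals all_analysis.
From mathcomp Require Import ring lra.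
Import Order.TTheory GRing.Theory Num.Theory.
Import numFieldNormedType.Exports.
Local Open Scope classical_set_scope.
Local Open Scope ring_scope.
Set Implicit Arguments.
Unset Strict Implicit.
Unset Printing Implicit Defensive.

(** The one substantial implication is that a linear map T sending
    [rho_*]-orthogonal pairs to Birkhoff orthogonal pairs multiplies every norm
    by the same constant. Fix u <> 0 and y, and put a = rho_+(u,y) / |u|^2.
    Then rho_+(u, y - a u) = 0, so Tu is Birkhoff orthogonal to T(y - a u).
    Since u + t y = (1 + t a) u + t (y - a u), this gives
      |T(u + t y)| >= |1 + t a| |Tu|   for every t,
    whereas |u + t y| = (1 + t a) |u| + o(t) as t -> 0+ by the choice of a.
    Hence the quotient |T(u + t y)|^2 / |u + t y|^2 decreases at most by o(t):
    restricted to a line missing the origin it is a continuous function whose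
    lower right Dini derivatives are nonnegative everywhere, so it is
    nondecreasing ([ler_of_lower_dini]). A line can be run through in both
    directions, so the quotient |Tx| / |x| takes the same value at any two
    linearly independent vectors, and by homogeneity at any two nonzero ones
    ([norm_ratio_le], [norm_ratio_const]).

    Conversely, if |Tx| = c |x| for all x, then T has operator norm c and
    multiplies each norm derivative by c^2, hence [rho_star] by c^4; and a map
    that multiplies [rho_star] by a constant preserves its zeros. Preserving
    [rho_*]-orthogonality implies mapping it to Birkhoff orthogonality because
    rho_- <= 0 <= rho_+ already forces the latter ([birkhoff_orth_of_rho]).

    As for semi-inner products, [Tx|Tx] = |T|^2 [x|x] says that T is a
    similarity. Conversely let |Tx| = c |x| with c <> 0. The Hahn-Banach
    theorem, proved here by taking a minimal sublinear functional, yields some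
    semi-inner product. The pullback, which replaces [x|y] by [Tx|Ty] / c^2,
    maps semi-inner products to semi-inner products. The averages of its first
    iterates are invariant up to O(1/n), and their limit along an ultrafilter
    is an invariant semi-inner product ([similarity_sip_exists]). Averaging is
    what copes with a T that is not surjective or has periodic points. *)

(** * Norm derivatives *)

Section NormDerivative.
Context (R : realType) (X : normedModType R).
Implicit Types (x y : X) (s t a : R).

Lemma sqnorm_convex x y s : 0 <= s <= 1 ->
  `|x + s *: y| ^+ 2 <= (1 - s) * `|x| ^+ 2 + s * `|x + y| ^+ 2.
Proof.
move=> /andP[s0 s1].
have E : x + s *: y = (1 - s) *: x + s *: (x + y).
  by rewrite scalerBl scale1r scalerDr addrA subrK.
have le : `|x + s *: y| <= (1 - s) * `|x| + s * `|x + y|.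
  rewrite E (le_trans (ler_normD _ _))// !normrZ (ger0_norm s0).
  by rewrite ger0_norm ?subr_ge0.
apply: (@le_trans _ _ (((1 - s) * `|x| + s * `|x + y|) ^+ 2)).
  by rewrite lerXn2r// ?nnegrE// (le_trans _ le).
rewrite -subr_ge0.
have -> : (1 - s) * `|x| ^+ 2 + s * `|x + y| ^+ 2 -
    ((1 - s) * `|x| + s * `|x + y|) ^+ 2 =
  (s * (1 - s)) * (`|x| - `|x + y|) ^+ 2 by ring.
by rewrite mulr_ge0 ?sqr_ge0// mulr_ge0 ?subr_ge0.
Qed.

Lemma norm_quotN x y t : norm_quot x y (- t) = - norm_quot x (- y) t.
Proof. by rewrite /norm_quot mulrN invrN mulrN scalerN scaleNr. Qed.

(** Slopes of the convex function t |-> |x + t y|^2. *)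
Lemma norm_quot_nondecreasing x y s t : 0 < s -> s <= t ->
  norm_quot x y s <= norm_quot x y t.
Proof.
move=> s0 st; have t0 : 0 < t by exact: lt_le_trans st.
have st1 : 0 <= s / t <= 1.
  by rewrite ler_pdivrMr// mul1r st andbT divr_ge0// ltW.
have := sqnorm_convex x (t *: y) st1.
rewrite scalerA divfK ?gt_eqF// => le.
rewrite /norm_quot ler_pdivrMr ?mulr_gt0//.
set A := `|x + s *: y| ^+ 2 in le *; set B := `|x + t *: y| ^+ 2 in le *.
have -> : (B - `|x| ^+ 2) / (2 * t) * (2 * s) = s / t * (B - `|x| ^+ 2).
  by field; rewrite gt_eqF.
by rewrite lerBlDr (le_trans le)// le_eqVlt; apply/orP; left; apply/eqP; ring.
Qed.

(** From |x + t y| >= |x| - t |y|; together with monotonicity this makes the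
    limit defining [rho_plus] exist. *)
Lemma norm_quot_lbound x y t : 0 < t -> - (`|x| * `|y|) <= norm_quot x y t.
Proof.
move=> t0; rewrite /norm_quot ler_pdivlMr ?mulr_gt0//.
have le : `|x| <= `|x + t *: y| + t * `|y|.
  rewrite -{1}(addrK (t *: y) x) (le_trans (ler_normB _ _))// normrZ.
  by rewrite gtr0_norm.
have := normr_ge0 (x + t *: y); have := normr_ge0 x; have := normr_ge0 y.
move: le; move: (`|x + t *: y|) (`|x|) (`|y|) => A B C le C0 B0 A0.
have [BC|BC] := leP B (t * C); first by have := sqr_ge0 A; nra.
suff : (B - t * C) ^+ 2 <= A ^+ 2 by have := sqr_ge0 (t * C); nra.
by rewrite lerXn2r ?nnegrE ?subr_ge0 ?(ltW BC)// lerBlDr.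
Qed.

Lemma rho_plus_cvg x y :
  norm_quot x y t @[t --> 0^'+] --> rho_plus x y.
Proof.
apply: nondecreasing_at_right_is_cvgr.
  apply: nearW => e s t; rewrite !in_itv/= => /andP[s0 _] /andP[t0 _] st.
  exact: norm_quot_nondecreasing.
apply: nearW => e; exists (- (`|x| * `|y|)) => _ [t + <-].
rewrite /= in_itv/= => /andP[t0 _].
exact: norm_quot_lbound.
Qed.

Lemma rho_minusE x y : rho_minus x y = - rho_plus x (- y).
Proof.
apply: cvg_lim => //; apply/cvg_at_leftNP; rewrite oppr0.
have -> : norm_quot x y \o -%R = fun t => - norm_quot x (- y) t.
  by apply/funext => t /=; rewrite norm_quotN.
have c := cvgN (@rho_plus_cvg x (- y)).
exact: c.
Qed.

Lemma rho_plus_le x y t : 0 < t -> rho_plus x y <= norm_quot x y t.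
Proof.
move=> t0; apply: (cvgr_to_le (@rho_plus_cvg x y)).
near=> s; apply: norm_quot_nondecreasing; near: s; first exact: nbhs_right_gt.
exact: nbhs_right_le.
Unshelve. all: by end_near. Qed.

(** By convexity 2 |x|^2 <= |x - t y|^2 + |x + t y|^2, so the left slope at -t
    is at most the right slope at t. *)
Lemma rho_minus_le_plus x y : rho_minus x y <= rho_plus x y.
Proof.
rewrite rho_minusE lerNl -subr_ge0 opprK.
have c : norm_quot x (- y) t + norm_quot x y t @[t --> 0^'+] -->
    rho_plus x (- y) + rho_plus x y by apply: cvgD; exact: rho_plus_cvg.
apply: (cvgr_to_ge c); near=> t.
have t0 : 0 < t by near: t; exact: nbhs_right_gt.
rewrite /= /norm_quot -mulrDl divr_ge0 ?mulr_ge0 ?(ltW t0)//.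
have le : 2 * `|x| <= `|x + t *: - y| + `|x + t *: y|.
  have -> : 2 * `|x| = `|(x + t *: - y) + (x + t *: y)|.
    rewrite scalerN addrACA addNr addr0 -mulr2n normrMn mulr_natl.
    by [].
  exact: ler_normD.
have := normr_ge0 x; move: le.
move: (`|x + t *: - y|) (`|x + t *: y|) (`|x|) => A B C le C0.
have : (2 * C) ^+ 2 <= (A + B) ^+ 2 by rewrite lerXn2r// nnegrE; lra.
have := sqr_ge0 (A - B); nra.
Unshelve. all: by end_near. Qed.

(** Slopes to the right of 0 are at least [rho_plus], and those to the left at
    most [rho_minus], so the signs say that t |-> |x + t y| is minimal at 0. *)
Lemma birkhoff_orth_of_rho x y :
  rho_minus x y <= 0 -> 0 <= rho_plus x y -> birkhoff_orth x y.
Proof.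
have key z t : 0 < t -> 0 <= rho_plus x z -> `|x| <= `|x + t *: z|.
  move=> t0 /le_trans/(_ (@rho_plus_le x z t t0)).
  rewrite /norm_quot pmulr_lge0 ?invr_gt0 ?mulr_gt0// subr_ge0.
  by rewrite ler_pXn2r// nnegrE.
rewrite rho_minusE oppr_le0 => xNy xy t.
have [t0|t0|->] := ltgtP t 0; last by rewrite scale0r addr0.
- by have := key (- y) (- t); rewrite oppr_gt0 scalerN scaleNr opprK; exact.
- exact: key.
Qed.

Lemma rho_star_orth_birkhoff x y : rho_star_orth x y -> birkhoff_orth x y.
Proof.
have := rho_minus_le_plus x y => le /eqP; rewrite mulf_eq0.
by case/orP => /eqP E; apply: birkhoff_orth_of_rho; rewrite -?E// E.
Qed.

(** This is what produces orthogonal pairs from arbitrary ones: a multiple of x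
    can always be subtracted from y to make [rho_plus] vanish. It rests on
    x + t (y - a x) = (1 - t a) (x + t / (1 - t a) y). *)
Lemma rho_plus_shift x y a :
  rho_plus x (y - a *: x) = rho_plus x y - a * `|x| ^+ 2.
Proof.
apply: cvg_lim => //.
have ct : (t : R) @[t --> 0^'+] --> (0 : R) by exact: cvg_at_right_filter.
have cd : 1 - t * a @[t --> 0^'+] --> (1 : R).
  rewrite -[X in _ --> X]subr0 -[X in _ - X](mul0r a).
  by apply: cvgB; [exact: cvg_cst|apply: cvgMl].
have cu : t / (1 - t * a) @[t --> 0^'+] --> (0 : R)^'+.
  suff c0 : t / (1 - t * a) @[t --> 0^'+] --> (0 : R).
    move=> A /c0 H; change (\forall t \near 0^'+, A (t / (1 - t * a))).
    have {}H : \forall t \near 0^'+, 0 < t / (1 - t * a) ->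
      A (t / (1 - t * a)) by exact: H.
    near=> t; apply: (near H t) => //.
    rewrite divr_gt0//.
    near: t; exact: (cvgr_gt _ cd).
  rewrite -[X in _ --> X](mul0r 1^-1).
  by apply: cvgM => //; apply: cvgV.
(* The quotient for y - a x, in terms of the one for y at t / (1 - t a). *)
have c : (1 - t * a) * norm_quot x y (t / (1 - t * a)) +
    (t * a ^+ 2 / 2 - a) * `|x| ^+ 2 @[t --> 0^'+] -->
    1 * rho_plus x y + (0 * a ^+ 2 / 2 - a) * `|x| ^+ 2.
  apply: cvgD.
    apply: cvgM => //.
    exact: (cvg_comp _ _ cu (@rho_plus_cvg x y)).
  apply: cvgMl; apply: cvgB; last exact: cvg_cst.
  by do 2 apply: cvgMl.
have -> : rho_plus x y - a * `|x| ^+ 2 =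
  1 * rho_plus x y + (0 * a ^+ 2 / 2 - a) * `|x| ^+ 2 by ring.
apply: cvg_trans c; apply: near_eq_cvg; near=> t.
have t0 : 0 < t by near: t; exact: nbhs_right_gt.
have d0 : 0 < 1 - t * a by near: t; exact: (cvgr_gt _ cd).
rewrite /norm_quot.
have -> : x + t *: (y - a *: x) = (1 - t * a) *: (x + (t / (1 - t * a)) *: y).
  rewrite [RHS]scalerDr scalerA [_ * (t / _)]mulrC divfK ?gt_eqF//.
  by rewrite scalerBr scalerA scalerBl scale1r addrA addrAC.
rewrite normrZ gtr0_norm//; set A := `|x + _|; field.
by rewrite !gt_eqF.
Unshelve. all: by end_near. Qed.

End NormDerivative.

(** * Constancy of the ratio of norms *)

(** If h drops by at most e s over a short step s to the right, then the last
    point t <= b at which h t + e t is at least its value at a must be b. *)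
Lemma ler_of_lower_dini (R : realType) (h : R -> R) :
    continuous h ->
    (forall t e, 0 < e -> \forall s \near 0^'+, h t - e * s <= h (t + s)) ->
  forall a b, a <= b -> h a <= h b.
Proof.
move=> hc hd a b ab.
suff key e : 0 < e -> h a - e * (b - a) <= h b.
  apply/ler_addgt0Pr => e e0.
  (* The summand 1 keeps the denominator positive when a = b. *)
  have d0 : 0 < b - a + 1 by lra.
  have := key (e / (b - a + 1)); rewrite divr_gt0// => /(_ isT).
  suff : e / (b - a + 1) * (b - a) <= e by lra.
  by rewrite mulrAC ler_pdivrMr// ler_wpM2l ?(ltW e0)//; lra.
move=> e0.
pose k t := h t + e * t.
have kc : continuous k.
  by move=> t; apply: cvgD; [exact: hc|apply: cvgMr].
pose S := [set t | t <= b /\ k a <= k t].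
have Sb : has_ubound S by exists b => t [].
have Sa : S a by split.
have S0 : S !=set0 by exists a.
have [cb kac] : S (sup S).
  suff Scl : closed S by apply: Scl; apply: closure_sup.
  apply: closedI; first exact: closed_le.
  apply: (@closed_comp _ _ k [set v | k a <= v]); last exact: closed_ge.
  by move=> t _; exact: kc.
have [cE|cb'] : sup S = b \/ sup S < b.
  by move: cb; rewrite le_eqVlt => /orP[/eqP|]; auto.
  by move: kac; rewrite cE /k; lra.
exfalso.
have [s /andP[s0 sb] hs] : exists2 s, 0 < s <= b - sup S &
    h (sup S) - e * s <= h (sup S + s).
  have H := hd (sup S) e e0.
  near (0 : R)^'+ => s; exists s; last exact: (near H s).
  apply/andP; split => //; near: s; apply: nbhs_right_le.
  by rewrite subr_gt0.
have : S (sup S + s).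
  by split; [lra|apply: (le_trans kac); rewrite /k; lra].
by move/(ub_le_sup Sb); lra.
Unshelve. all: by end_near. Qed.

Section ConstantRatio.
Context (R : realType) (X Y : normedModType R) (T : {linear X -> Y}).
Hypothesis TB : forall x y : X, rho_plus x y = 0 -> birkhoff_orth (T x) (T y).

(** The vector T(u + t y) is (1 + t a) Tu plus a multiple of T(y - a u), to
    which Tu is Birkhoff orthogonal. *)
Lemma image_norm_ge (u y : X) (a t : R) : rho_plus u y = a * `|u| ^+ 2 ->
  `|1 + t * a| * `|T u| <= `|T (u + t *: y)|.
Proof.
move=> aE.
have /TB B : rho_plus u (y - a *: u) = 0 by rewrite rho_plus_shift aE subrr.
have [d0|d0] := eqVneq (1 + t * a) 0; first by rewrite d0 normr0 mul0r.
have := B (t / (1 + t * a)).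
rewrite -(ler_pM2l (_ : 0 < `|1 + t * a|)) ?normr_gt0// => /le_trans; apply.
rewrite -normrZ scalerDr scalerA [_ * (t / _)]mulrC divfK//.
rewrite le_eqVlt; apply/orP; left; apply/eqP; congr `|_|.
rewrite [T (y - _)]linearB [T (a *: u)]linearZ.
rewrite [T (u + _)]linearD [T (t *: y)]linearZ/=.
by rewrite scalerDl scale1r scalerBr scalerA -addrA [X in _ + X]addrC subrK.
Qed.

(** Since |T(u + t y)| >= |1 + t a| |Tu|, the increment of the ratio is at
    least t G(t), where G is a bounded factor times
    ((1 + t a)^2 |u|^2 - |u + t y|^2) / t, and the latter tends to
    2 a |u|^2 - 2 rho_+(u,y) = 0. *)
Lemma sqnorm_ratio_dini (u y : X) (e : R) : u != 0 -> 0 < e ->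
  \forall t \near 0^'+, `|T u| ^+ 2 / `|u| ^+ 2 - e * t
    <= `|T (u + t *: y)| ^+ 2 / `|u + t *: y| ^+ 2.
Proof.
move=> u0 e0.
pose r := rho_plus u y; pose a := r / `|u| ^+ 2.
have P0 : 0 < `|u| ^+ 2 by rewrite exprn_gt0// normr_gt0.
have aE : a * `|u| ^+ 2 = r by rewrite /a divfK// gt_eqF.
have ct : (t : R) @[t --> 0^'+] --> (0 : R) by exact: cvg_at_right_filter.
have cP : `|u + t *: y| ^+ 2 @[t --> 0^'+] --> `|u| ^+ 2.
  have c : `|u + t *: y| @[t --> 0^'+] --> `|u|.
    apply: cvg_norm; rewrite -[X in _ --> X]addr0 -[X in _ + X](scale0r y).
    by apply: cvgD; [exact: cvg_cst|apply: cvgZl].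
  by rewrite !expr2; apply: cvgM.
(* F t = ((1 + t a)^2 |u|^2 - |u + t y|^2) / t *)
pose F t : R :=
  2 * a * `|u| ^+ 2 + t * (a ^+ 2 * `|u| ^+ 2) - 2 * norm_quot u y t.
have cF : F t @[t --> 0^'+] --> (0 : R).
  have E : 0 = 2 * a * `|u| ^+ 2 + 0 * (a ^+ 2 * `|u| ^+ 2) - 2 * r.
    by rewrite -aE; ring.
  rewrite [X in _ --> X]E.
  apply: cvgB; last by apply: cvgMr; exact: rho_plus_cvg.
  by apply: cvgD; [exact: cvg_cst|apply: cvgMl].
pose G t : R := `|T u| ^+ 2 / (`|u + t *: y| ^+ 2 * `|u| ^+ 2) * F t.
have cG : G t @[t --> 0^'+] --> (0 : R).
  rewrite -[X in _ --> X](mulr0 (`|T u| ^+ 2 / (`|u| ^+ 2 * `|u| ^+ 2))).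
  apply: cvgM => //; apply: cvgMr; apply: cvgV.
    by rewrite gt_eqF // mulr_gt0.
  exact: cvgMl.
near=> t.
have t0 : 0 < t by [].
have Gt : - e < G t by near: t; apply: (cvgr_gt _ cG); rewrite oppr_lt0.
have Pt : 0 < `|u + t *: y| ^+ 2 by near: t; exact: (cvgr_gt _ cP).
have Qt : (1 + t * a) ^+ 2 * `|T u| ^+ 2 <= `|T (u + t *: y)| ^+ 2.
  rewrite -(real_normK (num_real (1 + t * a))) -exprMn.
  by rewrite lerXn2r ?nnegrE ?mulr_ge0//; apply: image_norm_ge.
apply: (@le_trans _ _ ((1 + t * a) ^+ 2 * `|T u| ^+ 2 / `|u + t *: y| ^+ 2));
  last by rewrite ler_pM2r ?invr_gt0.
have -> : (1 + t * a) ^+ 2 * `|T u| ^+ 2 / `|u + t *: y| ^+ 2 =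
    `|T u| ^+ 2 / `|u| ^+ 2 + t * G t.
  have nt : 0 < `|u + t *: y|.
    rewrite normr_gt0; apply: contraTneq Pt => ->.
    by rewrite normr0 expr0n ltxx.
  by rewrite /G /F /norm_quot; field; rewrite !gt_eqF// normr_gt0.
by rewrite lerD2l -mulNr mulrC ler_wpM2l ?(ltW t0) ?(ltW Gt).
Unshelve. all: by end_near. Qed.

(** Monotonicity of the ratio along the line from x to y. Exchanging x and y
    turns the inequality into an equality. *)
Lemma norm_ratio_le (x y : X) : x != 0 -> y != 0 ->
  `|T x| / `|x| <= `|T y| / `|y|.
Proof.
move=> x0 y0.
have [[k yk]|yk] := pselect (exists k, y = k *: x).
  rewrite yk linearZ/= !normrZ -mulf_div divff ?mul1r//.
  by rewrite normr_eq0; apply: contra_neq y0 => k0; rewrite yk k0 scale0r.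
(* When y is not a multiple of x the line through them misses the origin. *)
pose l t := x + t *: (y - x).
have l0 t : l t != 0.
  apply/eqP => lt; have [t0|t0] := eqVneq t 0.
    by move: lt; rewrite /l t0 scale0r addr0; exact/eqP.
  apply: yk; exists (1 - t^-1); apply: (scalerI t0); move: lt.
  rewrite /l scalerA mulrBr mulr1 divff// scalerBr scalerBl scale1r.
  by move/eqP; rewrite addrCA addr_eq0 => /eqP ->; rewrite opprB.
pose h t := `|T (l t)| ^+ 2 / `|l t| ^+ 2.
have lc (V : normedModType R) (v w : V) :
    continuous (fun t : R => `|v + t *: w| ^+ 2).
  move=> t.
  have c : `|v + s *: w| @[s --> t] --> `|v + t *: w|.
    by apply: cvg_norm; apply: cvgD; [exact: cvg_cst|apply: cvgZl].
  exact: (cvgM c c).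
have hE : h = fun t => `|T x + t *: T (y - x)| ^+ 2 / `|x + t *: (y - x)| ^+ 2.
  by apply/funext => t; rewrite /h /l linearD linearZ.
have hc : continuous h.
  rewrite hE => t; apply: cvgM; first exact: lc.
  by apply: cvgV; [rewrite expf_eq0/= normr_eq0; exact: l0|exact: lc].
have hd t e : 0 < e -> \forall s \near 0^'+, h t - e * s <= h (t + s).
  move=> e0; have H := sqnorm_ratio_dini (y - x) (l0 t) e0.
  near=> s; rewrite /h {3 4}/l scalerDl addrA; exact: (near H s).
have := ler_of_lower_dini hc hd ler01.
rewrite /h /l scale0r addr0 scale1r addrC subrK -!expr_div_n.
by rewrite ler_pXn2r// nnegrE divr_ge0.
Unshelve. all: by end_near. Qed.

Lemma norm_ratio_const : exists2 c, 0 <= c & forall x : X, `|T x| = c * `|x|.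
Proof.
have [[x x0]|X0] := pselect (exists x : X, x != 0).
  exists (`|T x| / `|x|); first by rewrite divr_ge0.
  move=> y; have [->|y0] := eqVneq y 0; first by rewrite linear0 !normr0 mulr0.
  apply/eqP; rewrite -(can2_eq (divfK _) (mulfK _)) ?normr_eq0//.
  by rewrite eq_le !norm_ratio_le.
exists 0 => // x; rewrite mul0r; have [->|x0] := eqVneq x 0.
  by rewrite linear0 normr0.
by case: X0; exists x.
Qed.

End ConstantRatio.

(** * Minimal sublinear functionals and the Hahn-Banach theorem *)

(** Asking only for an inequality in the homogeneity makes infima of sublinear
    functionals easier to handle; equality follows ([sublinear_scale]). *)
Definition sublinear (R : realType) (V : lmodType R) (p : V -> R) : Prop :=
  (forall x y, p (x + y) <= p x + p y) /\
  (forall a x, 0 <= a -> p (a *: x) <= a * p x).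

Section HahnBanach.
Context (R : realType) (V : lmodType R).
Implicit Types (p m f : V -> R) (x y z : V).

Lemma sublinear_scale p x a : sublinear p -> 0 <= a -> p (a *: x) = a * p x.
Proof.
move=> [pD pZ]; rewrite le_eqVlt => /orP[/eqP <-|a0].
  apply/eqP; rewrite eq_le pZ// mul0r scale0r.
  by have := pD 0 0; rewrite addr0; lra.
apply/eqP; rewrite eq_le pZ ?(ltW a0)//=.
have := pZ a^-1 (a *: x); rewrite invr_ge0 (ltW a0) => /(_ isT).
by rewrite scalerA mulVf ?gt_eqF// scale1r ler_pdivlMl.
Qed.

Lemma sublinear_geN p x : sublinear p -> - p (- x) <= p x.
Proof.
move=> ps; have p0 := sublinear_scale 0 ps (lexx 0).
rewrite scale0r mul0r in p0.
by have := ps.1 x (- x); rewrite subrr p0; lra.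
Qed.

(** The common pattern of the two infima used below: along a ray, and over a
    chain of functionals. *)
Lemma sublinear_inf (S : V -> set R) :
    (forall x, S x !=set0) -> (forall x, has_lbound (S x)) ->
    (forall x y a b, S x a -> S y b -> exists2 c, S (x + y) c & c <= a + b) ->
    (forall x a b, 0 <= a -> S x b -> exists2 c, S (a *: x) c & c <= a * b) ->
  sublinear (fun x => inf (S x)).
Proof.
move=> S0 Slb SD SZ; split=> [x y|a x a0].
  rewrite -lerBlDr; apply: lb_le_inf => // a Sa.
  rewrite lerBlDr -lerBlDl; apply: lb_le_inf => // b Sb.
  have [c Sc cab] := SD _ _ _ _ Sa Sb.
  by rewrite lerBlDl (le_trans (ge_inf _ Sc)).
have le b : S x b -> inf (S (a *: x)) <= a * b.
  by move=> /(SZ _ _ _ a0)[c Sc cb]; rewrite (le_trans (ge_inf _ Sc)).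
move: a0 le; rewrite le_eqVlt => /orP[/eqP <-|a0] le.
  by have [b /le] := S0 x; rewrite !mul0r.
rewrite -ler_pdivrMl//; apply: lb_le_inf => // b /le.
by rewrite ler_pdivrMl.
Qed.

(** The infimum over t >= 0 of p(z + t x) - t p(x) is the largest such m. Its
    existence shows that minimal sublinear functionals are odd, and it also
    serves to prescribe the value of a functional at a point. *)
Lemma sublinear_descent p x : sublinear p -> exists m,
  [/\ sublinear m, forall z, m z <= p z & m (- x) <= - p x].
Proof.
move=> ps.
pose S z := [set p (z + t *: x) - t * p x | t in [set t : R | 0 <= t]].
have Slb z : has_lbound (S z).
  exists (- p (- z)) => _ [t t0 <-].
  have := ps.1 (z + t *: x) (- z); rewrite addrAC subrr add0r.
  by rewrite sublinear_scale//; lra.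
exists (fun z => inf (S z)); split.
- apply: sublinear_inf => //.
  + by move=> z; exists (p (z + 0 *: x) - 0 * p x); exists 0 => //=.
  + move=> z w _ _ [t t0 <-] [s s0 <-].
    exists (p (z + w + (t + s) *: x) - (t + s) * p x).
      by exists (t + s) => //=; exact: addr_ge0.
    by have := ps.1 (z + t *: x) (w + s *: x); rewrite addrACA -scalerDl; lra.
  + move=> z a _ a0 [t t0 <-].
    exists (p (a *: z + (a * t) *: x) - (a * t) * p x).
      by exists (a * t) => //=; exact: mulr_ge0.
    by have := ps.2 a (z + t *: x) a0; rewrite scalerDr scalerA; lra.
- move=> z; apply: ge_inf => //; exists 0 => //=.
  by rewrite scale0r addr0 mul0r subr0.
- apply: ge_inf => //; exists 1 => //=.
  rewrite scale1r addNr mul1r -[X in p X](scale0r x) sublinear_scale//.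
  by rewrite mul0r add0r.
Qed.

(** Zorn's lemma: the pointwise infimum of a chain below p is finite, since
    every sublinear m <= p satisfies m(z) >= - p(-z). *)
Lemma minimal_sublinear p : sublinear p -> exists m,
  [/\ sublinear m, forall z, m z <= p z &
      forall q, sublinear q -> (forall z, q z <= m z) -> forall z, m z <= q z].
Proof.
move=> ps.
pose M := {m : V -> R | sublinear m /\ forall z, m z <= p z}.
pose Rel (m q : M) := `[< forall z, sval q z <= sval m z >].
have [||A Atot|m mmin] :=
  @ZL_preorder M (exist _ p (conj ps (fun z => lexx _))) Rel.
- by move=> m; apply/asboolP.
- move=> r s t /asboolP sr /asboolP rt; apply/asboolP => z.
  exact: le_trans (rt z) (sr z).
- have [[m0 Am0]|A0] := pselect (A !=set0); last first.
    exists (exist _ p (conj ps (fun z => lexx _))) => s As.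
    by case: A0; exists s.
  pose S z := [set sval m z | m in A].
  have Slb z : has_lbound (S z).
    exists (- p (- z)) => _ [[m [ms mp]] _ <-] /=.
    by rewrite (le_trans _ (sublinear_geN z ms))// lerN2.
  have gs : sublinear (fun z => inf (S z)).
    apply: sublinear_inf => //.
    + by move=> z; exists (sval m0 z), m0.
    + move=> x y _ _ [m Am <-] [q Aq <-].
      have [/asboolP qm|/asboolP mq] := Atot _ _ Am Aq.
        exists (sval q (x + y)); first by exists q.
        by rewrite (le_trans ((svalP q).1.1 x y))// lerD2r.
      exists (sval m (x + y)); first by exists m.
      by rewrite (le_trans ((svalP m).1.1 x y))// lerD2l.
    + move=> x a _ a0 [m Am <-]; exists (sval m (a *: x)); first by exists m.
      exact: (svalP m).1.2.
  have gle (m : M) z : A m -> inf (S z) <= sval m z.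
    by move=> Am; apply: ge_inf => //; exists m.
  have gp z : inf (S z) <= p z.
    by rewrite (le_trans (gle m0 z Am0))// (svalP m0).2.
  exists (exist _ (fun z => inf (S z)) (conj gs gp)) => m Am.
  by apply/asboolP => z /=; exact: gle.
exists (sval m); have [ms mp] := svalP m; split => // q qs qm.
have qp z : q z <= p z by exact: le_trans (mp z).
have := mmin (exist _ q (conj qs qp)) => /(_ _)/asboolP; apply.
exact/asboolP.
Qed.

(** A minimal sublinear functional is odd, hence additive, hence linear. Taking
    it below the descent of p at x0 forces the value p(x0) there. *)
Lemma hahn_banach p x0 : sublinear p -> exists f,
  [/\ forall x y r t, f (r *: x + t *: y) = r * f x + t * f y,
      forall x, f x <= p x & f x0 = p x0].
Proof.
move=> ps; have [p' [ps' p'p p'x0]] := sublinear_descent x0 ps.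
have [f [fs fp' fmin]] := minimal_sublinear ps'.
have fN x : f (- x) = - f x.
  apply/eqP; rewrite eq_le; have [q [qs qf qx]] := sublinear_descent x fs.
  rewrite (le_trans (fmin _ qs qf _) qx)/=.
  by have := sublinear_geN x fs; lra.
have fD x y : f (x + y) = f x + f y.
  apply/eqP; rewrite eq_le fs.1/= -lerN2 -fN !opprD -!fN; exact: fs.1.
have fZ a x : f (a *: x) = a * f x.
  have [a0|a0] := leP 0 a; first exact: sublinear_scale.
  rewrite -[a]opprK scaleNr fN sublinear_scale ?mulNr// oppr_ge0; exact: ltW.
exists f; split => [x y r t|x|]; first by rewrite fD !fZ.
  exact: le_trans (fp' x) (p'p x).
apply/eqP; rewrite eq_le (le_trans (fp' x0) (p'p x0))/=.
by rewrite -lerN2 -fN (le_trans (fp' _)).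
Qed.

End HahnBanach.

(** * Semi-inner products invariant under a similarity *)

Section SemiInnerProducts.
Context (R : realType) (X : normedModType R).
Implicit Types ip : X -> X -> R.

(** Choose for each y a linear functional dominated by |y| |.| that attains
    |y|^2 at y. *)
Lemma semi_inner_product_exists : exists ip, semi_inner_product ip.
Proof.
suff /choice[f fP] : forall y : X, exists f : X -> R,
    [/\ forall x z r t, f (r *: x + t *: z) = r * f x + t * f z,
        forall x, `|f x| <= `|x| * `|y| & f y = `|y| ^+ 2].
  exists (fun x y => f y x); split => [x z y r t|x|x y].
  - by have [->] := fP y.
  - by have [] := fP x.
  - by have [] := fP y.
move=> y; have ps : sublinear (fun x : X => `|x| * `|y|).
  split => [x z|a x a0]; first by rewrite -mulrDl ler_wpM2r ?ler_normD.
  by rewrite normrZ ger0_norm// mulrA.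
have [f [fl fp fy]] := hahn_banach y ps; exists f; split => // x.
have fN : f (- x) = - f x.
  by have := fl x 0 (- 1) 0; rewrite scale0r addr0 scaleN1r mul0r addr0 mulN1r.
by rewrite ler_norml fp andbT lerNl -fN -(normrN x) fp.
Qed.

Lemma ultra_fmap (S T : Type) (f : S -> T) (F : set_system S) :
  UltraFilter F -> UltraFilter (f @ F).
Proof.
move=> FU; split => [|H HH FH]; first exact: fmap_proper_filter.
apply/seteqP; split => // B HB.
have [//|FB] := in_ultra_setVsetC (f @^-1` B) FU.
have /(filterI HB) : H (~` B) by exact: FH.
by rewrite setICr => /filter_not_empty.
Qed.

(** Values at (x, y) stay in the compact interval of radius |x| |y|, so they
    converge along G, and the three axioms are closed conditions. *)
Lemma sip_ultralimit (G : set_system nat) (ip : nat -> X -> X -> R) :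
    UltraFilter G -> (forall n, semi_inner_product (ip n)) ->
  exists2 L, semi_inner_product L &
    forall x y, ip n x y @[n --> G] --> L x y.
Proof.
move=> GU ips.
have cv x y : exists l : R, ip n x y @[n --> G] --> l.
  have := @segment_compact R (- (`|x| * `|y|)) (`|x| * `|y|).
  rewrite compact_ultra => /(_ _ (ultra_fmap (fun n => ip n x y) GU)).
  case => [|l [_ ?]]; last by exists l.
  apply: nearW => n /=; rewrite in_itv/= -ler_norml.
  exact: sip_cauchy_schwarz (ips n) x y.
have cv1 x : exists Lx : X -> R, forall y, ip n x y @[n --> G] --> Lx y.
  by have [Lx LxP] := choice (cv x); exists Lx.
have [L LP] := choice cv1.
exists L => //; split => [x y z r t|x|x y].
- apply: (cvg_unique _ (LP _ z)) => //.
  have -> : (fun n => ip n (r *: x + t *: y) z) =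
            (fun n => r * ip n x z + t * ip n y z).
    by apply/funext => n; rewrite (sip_linearl (ips n)).
  by apply: cvgD; apply: cvgMr.
- apply: (cvg_unique _ (LP x x)) => //.
  have -> : (fun n => ip n x x) = (fun n => `|x| ^+ 2).
    by apply/funext => n; rewrite (sip_norm (ips n)).
  exact: cvg_cst.
- have c : `|ip n x y| @[n --> G] --> `|L x y| by exact: cvg_norm.
  apply: (cvgr_to_le c).
  by apply: nearW => n; exact: sip_cauchy_schwarz.
Qed.

Lemma sip_mean (ip : nat -> X -> X -> R) (n : nat) :
    (forall k, semi_inner_product (ip k)) ->
  semi_inner_product (fun x y => n.+1%:R^-1 * \sum_(k < n.+1) ip k x y).
Proof.
move=> ips; split => [x y z r t|x|x y].
- rewrite [r * _]mulrCA [t * _]mulrCA -mulrDr; congr (_ * _).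
  rewrite !mulr_sumr -big_split/=; apply: eq_bigr => k _.
  by rewrite (sip_linearl (ips k)).
- rewrite (eq_bigr (fun=> `|x| ^+ 2)) => [|k _];
    last by rewrite (sip_norm (ips k)).
  by rewrite sumr_const card_ord -[X in _ * X]mulr_natl mulKf// pnatr_eq0.
- rewrite normrM ger0_norm ?invr_ge0// ler_pdivrMl ?ltr0Sn//.
  rewrite (le_trans (ler_norm_sum _ _ _))//.
  have -> : n.+1%:R * (`|x| * `|y|) = \sum_(k < n.+1) `|x| * `|y|.
    by rewrite sumr_const card_ord mulr_natl.
  by apply: ler_sum => k _; exact: sip_cauchy_schwarz (ips k) x y.
Qed.

Section Similarity.
Variables (T : {linear X -> X}) (c : R).
Hypotheses (c0 : c != 0) (Tc : forall x, `|T x| = c * `|x|).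

Let pullback ip (x y : X) : R := (c ^+ 2)^-1 * ip (T x) (T y).

Lemma sip_pullback ip :
  semi_inner_product ip -> semi_inner_product (pullback ip).
Proof.
have c20 : c ^+ 2 != 0 by rewrite expf_eq0.
move=> ips; split => [x y z r t|x|x y]; rewrite /pullback.
- by rewrite linearD !linearZ (sip_linearl ips)/=; ring.
- by rewrite (sip_norm ips) Tc exprMn mulKf.
- rewrite normrM ger0_norm ?invr_ge0 ?sqr_ge0//.
  rewrite ler_pdivrMl ?exprn_even_gt0//.
  by rewrite (le_trans (sip_cauchy_schwarz ips _ _))// !Tc mulrACA.
Qed.

(** The n-th mean of the iterated pullbacks differs from its own pullback by a
    telescoping sum, of size at most 2 |x| |y| / (n + 1). The limit is taken
    along an ultrafilter because the means themselves need not converge. *)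
Lemma similarity_sip_exists : exists2 ip,
  semi_inner_product ip & forall x y, ip (T x) (T y) = c ^+ 2 * ip x y.
Proof.
have [ip0 ip0s] := semi_inner_product_exists.
pose ip k := iter k pullback ip0.
have ips k : semi_inner_product (ip k) by elim: k => //= k; exact: sip_pullback.
pose A n x y := n.+1%:R^-1 * \sum_(k < n.+1) ip k x y.
have [G [GU Goo]] := @ultraFilterLemma nat \oo _.
have [L Ls LP] := @sip_ultralimit G A GU (fun n => sip_mean n ips).
exists L => // x y.
suff <- : pullback L x y = L x y by rewrite /pullback mulVKf// expf_eq0.
apply/eqP; rewrite -subr_eq0; apply/eqP.
have AE n :
    pullback (A n) x y - A n x y = n.+1%:R^-1 * (ip n.+1 x y - ip 0%N x y).
  rewrite /pullback /A mulrCA mulr_sumr -mulrBr -sumrB; congr (_ * _).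
  rewrite -(big_mkord xpredT (fun k => ip k.+1 x y - ip k x y)).
  by rewrite telescope_sumr.
have A0 : pullback (A n) x y - A n x y @[n --> \oo] --> (0 : R).
  apply: norm_cvg0.
  apply: (@squeeze_cvgr _ _ _ _ (cst 0)
    (fun n => 2 * (`|x| * `|y|) * harmonic n)); last 2 first.
  - exact: cvg_cst.
  - rewrite -[X in _ --> X](mulr0 (2 * (`|x| * `|y|))).
    by apply: cvgMr; exact: cvg_harmonic.
  apply: nearW => n; rewrite /= normr_ge0/= AE normrM ger0_norm ?invr_ge0//.
  rewrite mulrC ler_wpM2r ?invr_ge0// (le_trans (ler_normB _ _))//.
  rewrite [leRHS]mulr_natl mulr2n.
  by apply: lerD; [exact: sip_cauchy_schwarz (ips n.+1) x y|
    exact: sip_cauchy_schwarz ip0s x y].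
apply: (@cvg_unique _ _ (pullback (A n) x y - A n x y @[n --> G])) => //.
  by apply: cvgB => //; apply: cvgMr.
exact: (cvg_trans (cvg_fmap2 Goo) A0).
Qed.

End Similarity.
End SemiInnerProducts.

(** * Similarities and the equivalences *)

Section Similarities.
Context (R : realType) (X Y : normedModType R) (T : {linear X -> Y}).

(** The nonzero vector provides unit vectors: without any, the supremum
    would be -oo. *)
Lemma eopnorm_similarity (c : R) : (exists x : X, x != 0) ->
  (forall x, `|T x| = c * `|x|) -> eopnorm T = c%:E.
Proof.
move=> [x x0] Tc; rewrite /eopnorm.
have -> : [set (`|T x|)%:E | x in [set x : X | `|x| = 1]] = [set c%:E].
  apply/seteqP; split => [_ [z /= z1 <-]|_ ->] /=; first by rewrite Tc z1 mulr1.
  have x1 : `| `|x|^-1 *: x| = 1.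
    by rewrite normrZ normfV normr_id mulVf// normr_eq0.
  by exists (`|x|^-1 *: x) => //; rewrite Tc x1 mulr1.
exact: ereal_sup1.
Qed.

(** An identity between semi-inner products only controls the square of the
    operator norm; the sign is what allows taking square roots. *)
Lemma opnorm_ge0 : (exists x : X, x != 0) -> 0 <= opnorm T.
Proof.
move=> [x x0]; apply: fine_ge0.
apply: (@le_trans _ _ (`|T (`|x|^-1 *: x)|)%:E); first by rewrite lee_fin.
apply: ereal_sup_ubound; exists (`|x|^-1 *: x) => //=.
by rewrite normrZ normfV normr_id mulVf// normr_eq0.
Qed.

Lemma nonzero_domain : (exists x, T x <> 0) -> exists x : X, x != 0.
Proof.
by move=> [x Tx]; exists x; apply: contra_notN Tx => /eqP ->; exact: linear0.
Qed.

Lemma rho_plus_similarity (c : R) : (forall x, `|T x| = c * `|x|) ->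
  forall x y, rho_plus (T x) (T y) = c ^+ 2 * rho_plus x y.
Proof.
move=> Tc x y; apply: cvg_lim => //.
have -> : norm_quot (T x) (T y) = fun t => c ^+ 2 * norm_quot x y t.
  apply/funext => t; rewrite /norm_quot -linearZ -linearD !Tc !exprMn -mulrBr.
  by rewrite mulrA.
by apply: cvgMr; exact: rho_plus_cvg.
Qed.

Lemma rho_star_similarity (c : R) : (forall x, `|T x| = c * `|x|) ->
  forall x y, rho_star (T x) (T y) = c ^+ 4 * rho_star x y.
Proof.
move=> Tc x y; rewrite /rho_star !rho_minusE -linearN !(rho_plus_similarity Tc).
by ring.
Qed.

Hypothesis T0 : exists x, T x <> 0.

Lemma birkhoff_preserving_similarity :
    (forall x y : X, rho_star_orth x y -> birkhoff_orth (T x) (T y)) ->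
  finite_opnorm T /\ forall x, `|T x| = opnorm T * `|x|.
Proof.
move=> TB.
have [|c c0 Tc] := @norm_ratio_const R X Y T.
  by move=> x y xy; apply: TB; rewrite /rho_star_orth /rho_star xy mulr0.
rewrite /finite_opnorm /opnorm (eopnorm_similarity (nonzero_domain T0) Tc).
by rewrite ltry.
Qed.

Lemma similarity_preserves_rho_star_orth :
    finite_opnorm T /\
      (forall x y, rho_star (T x) (T y) = opnorm T ^+ 4 * rho_star x y) ->
  forall x y, rho_star_orth x y -> rho_star_orth (T x) (T y).
Proof. by move=> [_ Trho] x y xy; rewrite /rho_star_orth Trho xy mulr0. Qed.

End Similarities.

Theorem theorem2p5 (R : realType) (X : normedModType R) (hX : dim_ge X 2) :
  (forall (Y : normedModType R) (T : {linear X -> Y}),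
     (exists x : X, T x <> 0) ->
     [<-> (forall x y : X, rho_star_orth x y -> rho_star_orth (T x) (T y));
          (forall x y : X, rho_star_orth x y -> birkhoff_orth (T x) (T y));
          (finite_opnorm T /\ forall x : X, `|T x| = opnorm T * `|x|);
          (finite_opnorm T /\
           forall x y : X,
             rho_star (T x) (T y) = opnorm T ^+ 4 * rho_star x y)])
  /\
  (forall T : {linear X -> X},
     (exists x : X, T x <> 0) ->
     [<-> (forall x y : X, rho_star_orth x y -> rho_star_orth (T x) (T y));
          (forall x y : X, rho_star_orth x y -> birkhoff_orth (T x) (T y));
          (finite_opnorm T /\ forall x : X, `|T x| = opnorm T * `|x|);
          (finite_opnorm T /\
           forall x y : X,
             rho_star (T x) (T y) = opnorm T ^+ 4 * rho_star x y);
          (finite_opnorm T /\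
           exists ip : X -> X -> R, semi_inner_product ip /\
             forall x y : X, ip (T x) (T y) = opnorm T ^+ 2 * ip x y)]).
Proof.
have i_ii (Y : normedModType R) (T : {linear X -> Y}) :
    (forall x y : X, rho_star_orth x y -> rho_star_orth (T x) (T y)) ->
    forall x y : X, rho_star_orth x y -> birkhoff_orth (T x) (T y).
  by move=> TP x y /TP; exact: rho_star_orth_birkhoff.
split=> [Y T T0|T T0].
  tfae.
  - exact: i_ii.
  - exact: birkhoff_preserving_similarity.
  - by move=> [Tfin Tc]; split => //; exact: rho_star_similarity.
  - exact: similarity_preserves_rho_star_orth.
tfae.
- exact: i_ii.
- exact: birkhoff_preserving_similarity.
- by move=> [Tfin Tc]; split => //; exact: rho_star_similarity.
- move/similarity_preserves_rho_star_orth/i_ii.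
  move/(birkhoff_preserving_similarity T0) => [Tfin Tc]; split => //.
  have c0 : opnorm T != 0.
    by case: T0 => x; apply: contra_notN => /eqP c0; apply/eqP;
      rewrite -normr_eq0 Tc c0 mul0r.
  by have [ip ips ipT] := similarity_sip_exists c0 Tc; exists ip.
- move=> [Tfin [ip [ips ipT]]]; apply: similarity_preserves_rho_star_orth.
  split=> //; apply: rho_star_similarity => x; apply/eqP.
  have c0 := opnorm_ge0 T (nonzero_domain T0).
  rewrite -(@eqrXn2 _ 2)// ?mulr_ge0// exprMn -(sip_norm ips) ipT.
  by rewrite (sip_norm ips).
Qed.
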